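(* Let $(x^{*},y^{*})$ be a saddle-point of $f$. Suppose that for every $k\in\mathbf{N}$, $\lambda_k=\theta_k\le 1$ and $t_k=\frac{t_0}{\theta_1\cdots\theta_k}$, with $\lambda_0=\theta_0=1$ and $t_0\in\mathbf{R}_{++}$, and that for every $k\in\mathbf{N}$, $\tau_{k+1}\ge\frac{\tau_k}{\theta_{k+1}(1+\mu_1\tau_k)}$ and $\sigma_{k+1}\ge\frac{\sigma_k}{\theta_{k+1}(1+\mu_2\sigma_k)}$. Suppose moreover that $$\eta_x:=1-\sup_{k\in\mathbf{N}}\tau_k\left(L_{xx}\sup_{k\in\mathbf{N}}\lambda_k\alpha_k+L_{xy}\sup_{k\in\mathbf{N}}\lambda_k\beta_k+\frac{L_{xx}}{\inf_{k\in\mathbf{N}}\alpha_k}+\frac{L_{yx}}{\inf_{k\in\mathbf{N}}\gamma_k}\right)\in\mathbf{R}_{++}$$ and $$\eta_y:=1-\sup_{k\in\mathbf{N}}\sigma_k\left(L_{yx}\sup_{k\in\mathbf{N}}\theta_k\gamma_k+L_{yy}\sup_{k\in\mathbf{N}}\theta_k\delta_k+\frac{L_{xy}}{\inf_{k\in\mathbf{N}}\beta_k}+\frac{L_{yy}}{\inf_{k\in\mathbf{N}}\delta_k}\right)\in\mathbf{R}_{++}.$$ Then the following hold. (i) For every $K\in\mathbf{N}\smallsetminus\{0\}$, $0\le f(\hat x_K,y^{*})-f(x^{*},\hat y_K)\le\frac1K\left(\frac{1}{2\tau_0}\|x^{*}-x^0\|^2+\frac{1}{2\sigma_0}\|y^{*}-y^0\|^2\right)$.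 (ii) For every $k\in\mathbf{N}$, $t_ka_k(x^{*},y^{*})\ge t_{k+1}a_{k+1}(x^{*},y^{*})+\frac{t_0}{2}\left(\frac{\eta_x}{\tau_k}\|x^{k+1}-x^k\|^2+\frac{\eta_y}{\sigma_k}\|y^{k+1}-y^k\|^2\right)$. (iii) $\lim_{k\to\infty}t_ka_k(x^{*},y^{*})$ exists in $\mathbf{R}_+$, and $(x^k)_{k\in\mathbf{N}}$ and $(y^k)_{k\in\mathbf{N}}$ are bounded. (iv) $f(\hat x_k,\hat y_k)-f(x^{*},y^{*})\to0$ as $k\to\infty$.
   Context: $\mathbf{N}=\{0,1,2,\dots\}$, $\mathbf{R}_+=[0,\infty)$, $\mathbf{R}_{++}=(0,\infty)$; $\mathcal{H}_1,\mathcal{H}_2$ are real Hilbert spaces. Problem. $\Phi:\mathcal{H}_1\times\mathcal{H}_2\to\mathbf{R}\cup\{\pm\infty\}$, $f_i:\mathcal{H}_i\to\mathbf{R}\cup\{+\infty\}$ ($i=1,2$), and $f(x,y)=f_1(x)+\Phi(x,y)-f_2(y)$, with the convention $+\infty-(+\infty)=-\infty$; so $f(x,y)=f_1(x)+\Phi(x,y)-f_2(y)\in\mathbf{R}$ if $x\in\operatorname{dom}f_1$ and $y\in\operatorname{dom}f_2$; $f(x,y)=-\infty$ if $y\notin\operatorname{dom}f_2$; $f(x,y)=+\infty$ if $x\notin\operatorname{dom}f_1$ and $y\in\operatorname{dom}f_2$. Standing assumptions: each $f_i$ is proper, lower semicontinuous, and convex with modulus $\mu_i\ge0$ (i.e.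 $f_i-\frac{\mu_i}{2}\|\cdot\|^2$ is convex); $\operatorname{dom}f_1,\operatorname{dom}f_2$ are nonempty, closed and convex; for every $y\in\operatorname{dom}f_2$, $\Phi(\cdot,y):\mathcal{H}_1\to\mathbf{R}$ is convex and Fréchet differentiable (gradient $\nabla_x\Phi$); for every $x\in\operatorname{dom}f_1$, $\Phi(x,\cdot):\mathcal{H}_2\to\mathbf{R}$ is concave and Fréchet differentiable (gradient $\nabla_y\Phi$); there are $L_{xx},L_{xy},L_{yx},L_{yy}\in\mathbf{R}_+$ such that for all $(x,y),(x',y')\in\operatorname{dom}f_1\times\operatorname{dom}f_2$, $\|\nabla_x\Phi(x,y)-\nabla_x\Phi(x',y')\|\le L_{xx}\|x-x'\|+L_{xy}\|y-y'\|$ and $\|\nabla_y\Phi(x,y)-\nabla_y\Phi(x',y')\|\le L_{yx}\|x-x'\|+L_{yy}\|y-y'\|$. Saddle-point: $(x^{*},y^{*})\in\mathcal{H}_1\times\mathcal{H}_2$ with $f(x^{*},y)\le f(x^{*},y^{*})\le f(x,y^{*})$ for all $(x,y)\in\mathcal{H}_1\times\mathcal{H}_2$ (necessarily $(x^*,y^* )\in\operatorname{dom}f_1\times\operatorname{dom}f_2$). Algorithm. $(x^0,y^0)\in\operatorname{dom}f_1\times\operatorname{dom}f_2$, $x^{-1}=x^0$, $y^{-1}=y^0$; $(\tau_k),(\sigma_k),(\lambda_k),(\theta_k)$ ($k\in\mathbf{N}$) are sequences in $\mathbf{R}_{++}$; for every $k\in\mathbf{N}$, $x^{k+1}=\operatorname{Prox}_{\tau_kf_1}\big(x^k-\tau_k((1+\lambda_k)\nabla_x\Phi(x^k,y^k)-\lambda_k\nabla_x\Phi(x^{k-1},y^{k-1}))\big)$,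 $y^{k+1}=\operatorname{Prox}_{\sigma_kf_2}\big(y^k+\sigma_k((1+\theta_k)\nabla_y\Phi(x^k,y^k)-\theta_k\nabla_y\Phi(x^{k-1},y^{k-1}))\big)$, where $\operatorname{Prox}_{g}(u)=\operatorname{argmin}_z\,g(z)+\frac12\|z-u\|^2$. All iterates lie in $\operatorname{dom}f_1\times\operatorname{dom}f_2$. Auxiliary parameters: $(\alpha_k),(\beta_k),(\gamma_k),(\delta_k)$ are sequences in $\mathbf{R}_{++}$, $(t_k)$ is a sequence in $\mathbf{R}_+$ with $t_0>0$. For $K\in\mathbf{N}\smallsetminus\{0\}$: $\hat x_K=\frac{1}{\sum_{i=0}^{K-1}t_i}\sum_{k=0}^{K-1}t_kx^{k+1}$, $\hat y_K=\frac{1}{\sum_{i=0}^{K-1}t_i}\sum_{k=0}^{K-1}t_ky^{k+1}$. Suprema and infima are taken in $[0,+\infty]$ with $\frac10=+\infty$, $\frac{1}{+\infty}=0$, $0\cdot(+\infty)=0$. For $(x,y)\in\mathcal{H}_1\times\mathcal{H}_2$ and $k\in\mathbf{N}$: $a_k(x,y)=\frac{1}{2\tau_k}\|x-x^k\|^2+\frac{1}{2\sigma_k}\|y-y^k\|^2+\left(\frac{\lambda_kL_{xx}}{2\alpha_k}+\frac{\theta_kL_{yx}}{2\gamma_k}\right)\|x^k-x^{k-1}\|^2+\left(\frac{\lambda_kL_{xy}}{2\beta_k}+\frac{\theta_kL_{yy}}{2\delta_k}\right)\|y^k-y^{k-1}\|^2+\lambda_k\langle\nabla_x\Phi(x^k,y^k)-\nabla_x\Phi(x^{k-1},y^{k-1}),x-x^k\rangle-\theta_k\langle\nabla_y\Phi(x^k,y^k)-\nabla_y\Phi(x^{k-1},y^{k-1}),y-y^k\rangle.$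 *)

(* Defs.v *)
From HB Require Import structures.
From mathcomp Require Import all_boot all_order all_algebra.
From mathcomp Require Import sesquilinear.
From mathcomp Require Import all_classical all_reals all_analysis.

Set Implicit Arguments.
Unset Strict Implicit.
Unset Printing Implicit Defensive.

Import Order.TTheory GRing.Theory Num.Theory.
Import numFieldNormedType.Exports.

Local Open Scope classical_set_scope.
Local Open Scope ring_scope.

HB.mixin Record CompleteNormedModule_isHilbert (R : realType) V
    of CompleteNormedModule R V := {
  inner : {dot V for (@idfun R)} ;
  innerxx : forall u : V, inner u u = `|u| ^+ 2
}.

#[short(type="hilbertType")]
HB.structure Definition Hilbert (R : realType) :=
  {V of CompleteNormedModule_isHilbert R V & CompleteNormedModule R V}.

Notation "''[' u , v ]" := (inner u v) : ring_scope.

Definition dom (R : realType) (T : Type) (f : T -> \bar R) : set T :=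
  [set u | (f u < +oo)%E].

Definition eproper (R : realType) (T : Type) (f : T -> \bar R) : Prop :=
  (forall u, f u != -oo%E) /\ dom f !=set0.

(* Meant for functions that never take the value -oo; at s = 0 and s = 1 the
   inequality is harmless because 0 * +oo = 0 in \bar R. *)
Definition econvex (R : realType) (V : lmodType R) (f : V -> \bar R) : Prop :=
  forall (u v : V) (s : R), 0 <= s <= 1 ->
    (f (s *: u + (1 - s) *: v)%R <= s%:E * f u + (1 - s)%:E * f v)%E.

Definition convex_modulus (R : realType) (V : normedModType R) (mu : R)
    (f : V -> \bar R) : Prop :=
  econvex (fun u => (f u - (mu / 2 * `|u| ^+ 2)%:E)%E).

Definition argmin (R : realType) (T : Type) (f : T -> \bar R) : set T :=
  [set z | forall w, (f z <= f w)%E].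

(* [prox g u p] reads p = Prox_g(u): for g proper, lower semicontinuous and
   convex on a Hilbert space this set is a singleton. *)
Definition prox (R : realType) (V : normedModType R) (g : V -> \bar R) (u : V)
    : set V :=
  argmin (fun z => (g z + (2^-1 * `|z - u| ^+ 2)%:E)%E).

Definition is_gradient (R : realType) (V : hilbertType R) (F : V -> R) (u g : V)
    : Prop :=
  is_diff u (F : V -> R^o) (fun h : V => '[g, h] : R^o).

(* Addition in \bar R is such that +oo - +oo = -oo and -oo is absorbing, which
   is the convention wanted here: the value is -oo as soon as f2 y = +oo. *)
Definition saddle_fun (R : realType) (T1 T2 : Type) (f1 : T1 -> \bar R)
    (Phi : T1 -> T2 -> \bar R) (f2 : T2 -> \bar R) (x : T1) (y : T2) : \bar R :=
  (f1 x + Phi x y - f2 y)%E.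

Definition is_saddle (R : realType) (T1 T2 : Type) (f : T1 -> T2 -> \bar R)
    (xs : T1) (ys : T2) : Prop :=
  forall x y, (f xs y <= f xs ys)%E /\ (f xs ys <= f x ys)%E.

Definition seq_sup (R : realType) (u : nat -> R) : \bar R :=
  ereal_sup (range (fun k => (u k)%:E)).

Definition seq_inf (R : realType) (u : nat -> R) : \bar R :=
  ereal_inf (range (fun k => (u k)%:E)).

(* The weights are t_0, ..., t_(K-1), the averaged points z_1, ..., z_K. *)
Definition weighted_avg (R : realType) (V : lmodType R) (t : nat -> R)
    (z : nat -> V) (K : nat) : V :=
  (\sum_(i < K) t i)^-1 *: \sum_(k < K) t k *: z k.+1.

(* The sequences satisfy z_{-1} = z_0, so z_{k-1} is [z k.-1] for all k,
   including k = 0. *)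
Definition extrapolate (R : realType) (V : lmodType R) (c : R)
    (g : nat -> V) (k : nat) : V :=
  (1 + c) *: g k - c *: g k.-1.

Definition merit (R : realType) (H1 H2 : hilbertType R)
    (Gx : H1 -> H2 -> H1) (Gy : H1 -> H2 -> H2) (Lxx Lxy Lyx Lyy : R)
    (tau sigma lambda theta alpha beta gamma delta : nat -> R)
    (xk : nat -> H1) (yk : nat -> H2) (k : nat) (x : H1) (y : H2) : R :=
  (2 * tau k)^-1 * `|x - xk k| ^+ 2
  + (2 * sigma k)^-1 * `|y - yk k| ^+ 2
  + (lambda k * Lxx / (2 * alpha k) + theta k * Lyx / (2 * gamma k))
      * `|xk k - xk k.-1| ^+ 2
  + (lambda k * Lxy / (2 * beta k) + theta k * Lyy / (2 * delta k))
      * `|yk k - yk k.-1| ^+ 2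
  + lambda k * '[Gx (xk k) (yk k) - Gx (xk k.-1) (yk k.-1), x - xk k]
  - theta k * '[Gy (xk k) (yk k) - Gy (xk k.-1) (yk k.-1), y - yk k].

(* Main.v *)
(* Testing the prox inequalities and the gradient inequalities of Phi at a fixed
   point (x, y) bounds t_k times the gap f(x_(k+1), y) - f(x, y_(k+1)) by
   t_k a_k(x, y) - t_(k+1) a_(k+1)(x, y) minus a multiple of the squared steps:
   since t_(k+1) lambda_(k+1) = t_k, the extrapolation terms telescope, and
   Young's inequality absorbs the remaining cross terms. As a_k >= 0, summing
   and Jensen's inequality bound the gap of the averages by O(1/K), for every
   (x, y) in the domain. At the saddle point (xs, ys) this gives (i)-(iii). The
   gap bound at the moving points (xs, yhat_K) and (xhat_K, ys) squeezes
   f(xhat_K, yhat_K) between f(xs, ys) - O(1/K) and f(xs, ys) + O(1/K), provided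
   the iterates are bounded. They are when sup tau is finite, because
   a_k >= eta_x |xs - x_k|^2 / (2 tau_k); otherwise positivity of eta_x forces
   Lxx = Lxy = 0, the x-iteration is a proximal point iteration with a constant
   linear term, and |xs - x_k| is nonincreasing (likewise for y). *)
Require Import Defs.
From HB Require Import structures.
From mathcomp Require Import all_boot all_order all_algebra.
From mathcomp Require Import sesquilinear ring lra.
From mathcomp Require Import all_classical all_reals all_analysis.

Set Implicit Arguments.
Unset Strict Implicit.
Unset Printing Implicit Defensive.

Import Order.TTheory GRing.Theory Num.Theory.
Import numFieldNormedType.Exports.

Local Open Scope classical_set_scope.
Local Open Scope ring_scope.

(** * Inner products, Cauchy-Schwarz and Young's inequality *)

Section InnerProduct.
Context (R : realType) (V : hilbertType R).
Implicit Types u v w : V.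

Lemma innerC u v : inner u v = inner v u.
Proof. by rewrite hermC /= expr0 mul1r. Qed.

Lemma innerDl u v w : inner (u + v) w = inner u w + inner v w.
Proof. exact: (linearDl inner). Qed.

Lemma innerNl u v : inner (- u) v = - inner u v.
Proof. exact: (linearNl inner). Qed.

Lemma innerZl (a : R) u v : inner (a *: u) v = a * inner u v.
Proof. exact: (linearZl_LR inner). Qed.

Lemma innerDr u v w : inner u (v + w) = inner u v + inner u w.
Proof. by rewrite innerC innerDl !(innerC u). Qed.

Lemma innerNr u v : inner u (- v) = - inner u v.
Proof. by rewrite innerC innerNl innerC. Qed.

Lemma innerZr (a : R) u v : inner u (a *: v) = a * inner u v.
Proof. by rewrite innerC innerZl innerC. Qed.

Definition innerE := (innerDl, innerDr, innerNl, innerNr, innerZl, innerZr).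

Lemma normsqrD u v : `|u + v| ^+ 2 = `|u| ^+ 2 + 2 * inner u v + `|v| ^+ 2.
Proof. by rewrite -!innerxx !innerE (innerC v u); ring. Qed.

(** Cauchy-Schwarz: squaring the triangle inequality of the norm leaves only the cross term. *)
Lemma inner_le u v : inner u v <= `|u| * `|v|.
Proof.
have : `|u + v| ^+ 2 <= (`|u| + `|v|) ^+ 2.
  by rewrite ler_pXn2r ?nnegrE ?addr_ge0// ler_normD.
rewrite normsqrD; lra.
Qed.

(** Cauchy-Schwarz, then Young on [a * |w|] with weight [alpha] and on [b * |w|] with weight [beta].
    In the applications [u] is a gradient increment, bounded by a Lipschitz estimate. *)
Lemma inner_young (u w : V) (a b La Lb alpha beta : R) :
  `|u| <= La * a + Lb * b -> 0 <= La -> 0 <= Lb -> 0 < alpha -> 0 < beta ->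
  inner u w <= (La / (2 * alpha)) * a ^+ 2 + (Lb / (2 * beta)) * b ^+ 2
               + (La * alpha + Lb * beta) / 2 * `|w| ^+ 2.
Proof.
move=> uab La0 Lb0 al0 be0.
have young (c e : R) : 0 < e ->
    c * `|w| <= c ^+ 2 / (2 * e) + e / 2 * `|w| ^+ 2.
  move=> e0; rewrite -subr_ge0.
  have -> : c ^+ 2 / (2 * e) + e / 2 * `|w| ^+ 2 - c * `|w|
            = (c - e * `|w|) ^+ 2 / (2 * e) by field; rewrite gt_eqF.
  by rewrite divr_ge0 ?sqr_ge0// mulr_ge0 ?ltW.
have := ler_wpM2r (normr_ge0 w) uab.
have := ler_wpM2l La0 (young a alpha al0).
have := ler_wpM2l Lb0 (young b beta be0).
have := inner_le u w.
lra.
Qed.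

End InnerProduct.

(** Replaces the passage to the limit [s -> 0] in the comparison arguments with convex
    combinations. *)
Lemma ler_of_slope (R : realType) (a b c : R) :
  (forall s, 0 < s < 1 -> a <= b + s * c) -> a <= b.
Proof.
move=> h; rewrite leNgt; apply/negP => ba.
(* The choice of [s] makes [s * c] at most half of [a - b]; the added 1 keeps the denominator
   positive when [c = 0]. *)
have c1 : 0 < `|c| + 1 by rewrite ltr_wpDl.
pose s := Num.min (1 / 2) ((a - b) / (2 * (`|c| + 1))).
have s0 : 0 < s by rewrite lt_min divr_gt0//= divr_gt0 ?subr_gt0 ?mulr_gt0.
have s1 : s < 1 by rewrite gt_min; apply/orP; left; lra.
have sc : s * c <= (a - b) / 2.
  have -> : (a - b) / 2 = (a - b) / (2 * (`|c| + 1)) * (`|c| + 1).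
    by field; rewrite gt_eqF.
  rewrite (le_trans (ler_wpM2l (ltW s0) (ler_norm c)))//.
  rewrite ler_pM// ?(ltW s0)// ?ge_min ?lexx ?orbT//; lra.
have := h s; rewrite s0 s1 => /(_ isT); lra.
Qed.

(** Real-valued counterpart of convexity with modulus for extended-valued functions: [D] stands for
    the effective domain, whose convexity is built in. *)
Definition strongly_convex_on (R : realType) (V : normedModType R) (D : set V)
    (mu : R) (F : V -> R) : Prop :=
  forall u v s, D u -> D v -> 0 <= s <= 1 ->
    D (s *: u + (1 - s) *: v) /\
    F (s *: u + (1 - s) *: v)
      <= s * F u + (1 - s) * F v - mu / 2 * (s * (1 - s) * `|u - v| ^+ 2).

(** * Strong convexity, proximal steps and Jensen's inequality *)

Section Convexity.
Context (R : realType) (V : hilbertType R).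
Implicit Types (D : set V) (F : V -> R).

(** The quadratic correction is the identity [s|u|^2 + (1-s)|v|^2 - |su + (1-s)v|^2 =
    s(1-s)|u-v|^2]. *)
Lemma convex_modulus_strongly_convex_on (mu : R) (f : V -> \bar R) :
  (forall u, f u != -oo%E) -> convex_modulus mu f ->
  strongly_convex_on (dom f) mu (fine \o f).
Proof.
move=> fNy cf u v s Du Dv /andP[s0 s1].
have fE w : dom f w -> f w = (fine (f w))%:E.
  by move=> Dw; rewrite fineK// fin_numE fNy lt_eqF.
have := cf u v s; rewrite s0 s1 => /(_ isT).
rewrite (fE u Du) (fE v Dv) -!EFinB -!EFinM -EFinD => h.
(* If [f] were infinite here, the convexity inequality would place +oo below a real number. *)
have Dz : dom f (s *: u + (1 - s) *: v).
  rewrite /dom/= ltey; apply/eqP => fy.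
  by move: h; rewrite fy.
split=> //=; move: h; rewrite (fE _ Dz) -EFinB lee_fin.
rewrite -!innerxx !innerE (innerC v u); lra.
Qed.

Lemma strongly_convex_on_ge0 D (mu : R) F :
  0 <= mu -> strongly_convex_on D mu F -> strongly_convex_on D 0 F.
Proof.
move=> mu0 cF u v s Du Dv /andP[s0 s1].
have [|Dz Fz] := cF u v s Du Dv; first by rewrite s0.
split=> //; apply: le_trans Fz _.
rewrite !mul0r subr0 gerBl mulr_ge0 ?divr_ge0//.
by rewrite !mulr_ge0// subr_ge0.
Qed.

Lemma strongly_convex_onD D F G :
  strongly_convex_on D 0 F -> strongly_convex_on setT 0 G ->
  strongly_convex_on D 0 (fun u => F u + G u).
Proof.
move=> cF cG u v s Du Dv s01.
have [Dz Fz] := cF u v s Du Dv s01; have [_ Gz] := cG u v s I I s01.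
by split=> //; lra.
Qed.

(** The zero function serves to feed the convexity of the ball to [weighted_avg_jensen], so that
    averages of bounded iterates inherit the bound. *)
Lemma strongly_convex_on_ball (M : R) :
  strongly_convex_on [set u : V | `|u| <= M] 0 (fun=> 0).
Proof.
move=> u v s /= uM vM /andP[s0 s1]; split; last by lra.
rewrite (le_trans (ler_normD _ _))// !normrZ ger0_norm// ger0_norm ?subr_ge0//.
have := ler_wpM2l s0 uM; have : (1 - s) * `|v| <= (1 - s) * M.
  by rewrite ler_wpM2l// subr_ge0.
lra.
Qed.

Lemma convex_function_strongly_convex_on F :
  convex_function setT F -> strongly_convex_on setT 0 F.
Proof.
move=> cF u v s _ _ /andP[s0 s1]; split=> //.
have := cF (Itv01 s0 s1) u v (mem_set I) (mem_set I).
by rewrite convRE /= /unstable.onem !mul0r subr0.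
Qed.

(** Convexity bounds every difference quotient from [u] towards [v] by [F v - F u]; as [h] decreases
    to 0 the quotients tend to the directional derivative. *)
Lemma convex_gradient_le F (u g v : V) :
  strongly_convex_on setT 0 F -> is_gradient F u g ->
  F u + inner g (v - u) <= F v.
Proof.
move=> cF [dF dFE].
have /(_ (v - u)) dD := fun w => diff_derivable (v := w) dF.
have := deriveE (v - u) dF; rewrite dFE => DE.
have : h^-1 *: ((F \o shift u) (h *: (v - u)) - F u) @[h --> 0^'+]
    --> inner g (v - u).
  rewrite -DE; apply: cvg_dnbhs_at_right; exact: dD.
move=> /cvgr_to_le H.
suff : inner g (v - u) <= F v - F u by lra.
apply: H; near=> h.
have h0 : 0 < h by near: h; exact: nbhs_right_gt.
have h1 : h < 1 by near: h; exact: nbhs_right_lt.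
have [|_] := cF v u h I I; first by rewrite !ltW.
have -> : h *: v + (1 - h) *: u = h *: (v - u) + u.
  by rewrite scalerBl scale1r scalerBr addrCA addrC.
rewrite /= /shift/= => le.
rewrite -[_ *: _]/(_ * _) mulrC ler_pdivrMr//; lra.
Unshelve. all: by end_near.
Qed.

(** Minimality of [p] is tested against [s x + (1-s) p]; after division by [s], letting [s] tend to
    0 gives the claim. *)
Lemma prox_variational D (mu tau : R) F (u p x : V) :
  strongly_convex_on D mu F -> 0 < tau -> D p -> D x ->
  (forall z, D z ->
    tau * F p + 2^-1 * `|p - u| ^+ 2 <= tau * F z + 2^-1 * `|z - u| ^+ 2) ->
  F p + tau^-1 * inner (u - p) (x - p) + mu / 2 * `|x - p| ^+ 2 <= F x.
Proof.
move=> cF tau0 Dp Dx pmin.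
suff : tau * F p + inner (u - p) (x - p) + tau * (mu / 2 * `|x - p| ^+ 2)
    <= tau * F x.
  move=> h; rewrite -(ler_pM2l tau0); apply: le_trans h.
  by rewrite !mulrDr mulVKf// gt_eqF.
(* The slope gathers the terms of order [s^2]: one from the expanded square, one from the factor
   [s(1-s)] of strong convexity. *)
apply: (@ler_of_slope _ _ _ ((tau * mu + 1) / 2 * `|x - p| ^+ 2)).
move=> s /andP[s0 s1].
have [|Dz Fz] := cF x p s Dx Dp; first by rewrite !ltW.
have := le_trans (pmin _ Dz) (lerD (ler_wpM2l (ltW tau0) Fz) (lexx _)).
have -> : s *: x + (1 - s) *: p - u = (p - u) + s *: (x - p).
  by rewrite scalerBl scale1r scalerBr addrCA addrAC.
rewrite (normsqrD (p - u)) normrZ exprMn ger0_norm ?(ltW s0)// innerZr.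
have -> : inner (u - p) (x - p) = - inner (p - u) (x - p).
  by rewrite -innerNl opprB.
move=> h; rewrite -(ler_pM2l s0); lra.
Qed.

(** Induction on the number of points: the new average is a convex combination of the old average
    and the new point, with weights [s] and [1 - s]. *)
Lemma weighted_avg_jensen D F (t : nat -> R) (z : nat -> V) (K : nat) :
  strongly_convex_on D 0 F -> (forall k, 0 < t k) -> (forall k, D (z k.+1)) ->
  (0 < K)%N ->
  D (weighted_avg t z K) /\
  (\sum_(i < K) t i) * F (weighted_avg t z K) <= \sum_(k < K) t k * F (z k.+1).
Proof.
(* The induction starts at one point, since the empty average is 0 and may lie outside [D]. *)
move=> cF t0 Dz; case: K => // K _; elim: K => [|K [DK FK]].
  by rewrite /weighted_avg !big_ord1 scalerA mulVf ?gt_eqF// scale1r.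
have sum_gt0 n : 0 < \sum_(i < n.+1) t i.
  by rewrite big_ord_recr/= ltr_wpDl// sumr_ge0// => i _; exact: ltW.
set T := \sum_(i < K.+1) t i in FK; have T0 : 0 < T := sum_gt0 K.
have TS : \sum_(i < K.+2) t i = T + t K.+1 by rewrite big_ord_recr.
have TS0 : 0 < T + t K.+1 by rewrite addr_gt0.
pose s := T / (T + t K.+1).
have s1E : 1 - s = t K.+1 / (T + t K.+1) by rewrite /s; field; rewrite gt_eqF.
have avgS : weighted_avg t z K.+2
    = s *: weighted_avg t z K.+1 + (1 - s) *: z K.+2.
  rewrite {1}/weighted_avg TS big_ord_recr/= scalerDr s1E.
  rewrite /weighted_avg -/T !scalerA [RHS]/= ; congr (_ *: _ + _ *: _).
    by rewrite /s mulrAC mulfV ?gt_eqF// mul1r.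
  exact: mulrC.
have s01 : 0 <= s <= 1.
  rewrite /s; apply/andP; split; first by rewrite divr_ge0// ltW.
  by rewrite ler_pdivrMr// mul1r lerDl ltW.
have [Davg Favg] := cF _ _ s DK (Dz K.+1) s01.
rewrite avgS TS; split=> //.
rewrite big_ord_recr/=; apply: le_trans (lerD FK (lexx _)).
apply: le_trans (ler_wpM2l (ltW TS0) Favg) _.
rewrite !mul0r subr0 s1E /s le_eqVlt; apply/orP; left; apply/eqP.
by field; rewrite gt_eqF.
Qed.

(** Here [g0], [g1], [g2] are the gradients at the previous, current and next iterates. Writing the
    extrapolated gradient as [g2 - (g2 - g1) + lam (g1 - g0)] and splitting [x - z'] as
    [(x - z) - (z' - z)] yields matching inner products at consecutive indices. *)
Lemma forward_backward_step D (mu tau lam : R) F (z z' g0 g1 g2 x : V) :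
  strongly_convex_on D mu F -> 0 < tau -> D z' -> D x ->
  (forall w, D w ->
    let u := z - tau *: ((1 + lam) *: g1 - lam *: g0) in
    tau * F z' + 2^-1 * `|z' - u| ^+ 2 <= tau * F w + 2^-1 * `|w - u| ^+ 2) ->
  F z' - F x + inner g2 (z' - x) <=
    (2 * tau)^-1 * `|x - z| ^+ 2 + lam * inner (g1 - g0) (x - z)
    - ((1 + mu * tau) / (2 * tau) * `|x - z'| ^+ 2 + inner (g2 - g1) (x - z'))
    - (2 * tau)^-1 * `|z' - z| ^+ 2 - lam * inner (g1 - g0) (z' - z).
Proof.
move=> cF tau0 Dz' Dx /(prox_variational cF tau0 Dz' Dx).
(* The three-point identity converts the proximal inner product into squared distances. *)
have -> : `|x - z| ^+ 2 = `|x - z'| ^+ 2 + `|z' - z| ^+ 2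
    - 2 * inner (z - z') (x - z').
  rewrite -[x - z](subrKA z') (normsqrD (x - z')) -(opprB z' z) innerNl.
  by rewrite innerC; lra.
rewrite (addrAC z) (innerDl (z - z')) innerNl innerZl mulrBr mulKf ?gt_eqF//.
have -> : (1 + mu * tau) / (2 * tau) = (2 * tau)^-1 + mu / 2.
  by field; rewrite gt_eqF.
rewrite invfM !innerE; lra.
Qed.

(** [c] will be the factor multiplying [tau k] in the step size condition. If it is positive, the
    step sizes are at most [1 / c]; if it vanishes, the linear term is constant and [xs] minimizes
    [F + inner gs], so distances to [xs] do not increase. *)
Lemma proximal_iterates_bounded D (mu eta A c : R) F (tau lam : nat -> R)
    (z g : nat -> V) (xs gs : V) :
  0 <= mu -> strongly_convex_on D mu F -> (forall k, 0 < tau k) ->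
  (forall k, D (z k)) -> D xs ->
  (forall k w, D w ->
    let u := z k - tau k *: extrapolate (lam k) g k in
    tau k * F (z k.+1) + 2^-1 * `|z k.+1 - u| ^+ 2
      <= tau k * F w + 2^-1 * `|w - u| ^+ 2) ->
  0 < eta -> (forall k, eta / (2 * tau k) * `|xs - z k| ^+ 2 <= A) ->
  0 <= c -> (forall k, tau k * c <= 1) ->
  (c = 0 -> (forall k, g k = gs) /\
            (forall x, D x -> F xs <= F x + inner gs (x - xs))) ->
  exists M, forall k, `|z k| <= M.
Proof.
move=> mu0 cF tau0 Dz Dxs step eta0 zA c0 tauc gconst.
suff [M zM] : exists M, forall k, `|xs - z k| <= M.
  exists (M + `|xs|) => k; rewrite -lerBlDr; apply: le_trans (zM k).
  by rewrite distrC lerB_dist.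
have [c_gt0|] := ltP 0 c; last first.
  move=> c_le0; have c_eq0 : c = 0 by apply/le_anti/andP.
  have [gE optimal] := gconst c_eq0.
  exists `|xs - z 0%N|; elim=> [//|k IH]; apply: le_trans IH.
  rewrite -(@ler_pXn2r _ 2) ?nnegrE//.
  have := forward_backward_step gs cF (tau0 k) (Dz k.+1) Dxs (@step k).
  rewrite !gE !subrr !linear0l.
  have := optimal _ (Dz k.+1).
  have : 0 <= (2 * tau k)^-1 * `|z k.+1 - z k| ^+ 2.
    by rewrite mulr_ge0 ?sqr_ge0// invr_ge0 mulr_ge0// ltW.
  have : 0 <= mu / 2 * `|xs - z k.+1| ^+ 2.
    by rewrite mulr_ge0 ?sqr_ge0// divr_ge0.
  have -> : (1 + mu * tau k) / (2 * tau k) = (2 * tau k)^-1 + mu / 2.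
    by field; rewrite gt_eqF.
  have t2 : 0 < (2 * tau k)^-1 by rewrite invr_gt0 mulr_gt0.
  by move=> ? ? ? ?; rewrite -(ler_pM2l t2); lra.
(* The square of the distance is at most [2 A / (eta c)], and [r <= r^2 + 1] avoids a square
   root. *)
exists (2 * A / (eta * c) + 1) => k.
have A0 : 0 <= A.
  apply: le_trans (zA k).
  by rewrite mulr_ge0 ?sqr_ge0// divr_ge0 ?mulr_ge0// ltW.
suff : `|xs - z k| ^+ 2 <= 2 * A / (eta * c).
  by have := sqr_ge0 (`|xs - z k| - 1); have := sqr_ge0 `|xs - z k|; lra.
rewrite ler_pdivlMr ?mulr_gt0//.
have := ler_wpM2r A0 (tauc k).
have := ler_wpM2l (ltW (mulr_gt0 (tau0 k) c_gt0)) (zA k).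
have -> : tau k * c * (eta / (2 * tau k) * `|xs - z k| ^+ 2)
   = c * eta * `|xs - z k| ^+ 2 / 2 by field; rewrite gt_eqF.
lra.
Qed.

End Convexity.

(** * One-step and ergodic estimates for the real-valued problem *)

Section PrimalDual.
Context (R : realType) (H1 H2 : hilbertType R) (D1 : set H1) (D2 : set H2).
Context (F1 : H1 -> R) (F2 : H2 -> R) (P : H1 -> H2 -> R) (mu1 mu2 : R).
Context (Gx : H1 -> H2 -> H1) (Gy : H1 -> H2 -> H2) (Lxx Lxy Lyx Lyy : R).
Context (xk : nat -> H1) (yk : nat -> H2).
Context (tau sigma lambda theta alpha beta gamma delta t : nat -> R).
Context (eta_x eta_y : R).

Hypothesis (mu1_ge0 : 0 <= mu1) (mu2_ge0 : 0 <= mu2).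
Hypothesis (F1_convex : strongly_convex_on D1 mu1 F1).
Hypothesis (F2_convex : strongly_convex_on D2 mu2 F2).
Hypothesis (P_convex : forall y, D2 y -> strongly_convex_on setT 0 (P^~ y)).
Hypothesis (P_concave :
  forall x, D1 x -> strongly_convex_on setT 0 (fun y => - P x y)).
Hypothesis (P_gradx : forall x x' y, D2 y ->
  P x y + inner (Gx x y) (x' - x) <= P x' y).
Hypothesis (P_grady : forall x y y', D1 x ->
  P x y' <= P x y + inner (Gy x y) (y' - y)).
Hypothesis (Lxx_ge0 : 0 <= Lxx) (Lxy_ge0 : 0 <= Lxy).
Hypothesis (Lyx_ge0 : 0 <= Lyx) (Lyy_ge0 : 0 <= Lyy).
Hypothesis (Gx_lip : forall x y x' y', D1 x -> D2 y -> D1 x' -> D2 y' ->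
  `|Gx x y - Gx x' y'| <= Lxx * `|x - x'| + Lxy * `|y - y'|).
Hypothesis (Gy_lip : forall x y x' y', D1 x -> D2 y -> D1 x' -> D2 y' ->
  `|Gy x y - Gy x' y'| <= Lyx * `|x - x'| + Lyy * `|y - y'|).
Hypothesis (xk_dom : forall k, D1 (xk k)) (yk_dom : forall k, D2 (yk k)).
Hypothesis (tau_gt0 : forall k, 0 < tau k) (sigma_gt0 : forall k, 0 < sigma k).
Hypothesis (lambda_gt0 : forall k, 0 < lambda k).
Hypothesis (theta_gt0 : forall k, 0 < theta k).
Hypothesis (x_step : forall k w, D1 w ->
  let u := xk k
    - tau k *: extrapolate (lambda k) (fun j => Gx (xk j) (yk j)) k in
  tau k * F1 (xk k.+1) + 2^-1 * `|xk k.+1 - u| ^+ 2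
    <= tau k * F1 w + 2^-1 * `|w - u| ^+ 2).
Hypothesis (y_step : forall k w, D2 w ->
  let u := yk k
    + sigma k *: extrapolate (theta k) (fun j => Gy (xk j) (yk j)) k in
  sigma k * F2 (yk k.+1) + 2^-1 * `|yk k.+1 - u| ^+ 2
    <= sigma k * F2 w + 2^-1 * `|w - u| ^+ 2).
Hypothesis (alpha_gt0 : forall k, 0 < alpha k).
Hypothesis (beta_gt0 : forall k, 0 < beta k).
Hypothesis (gamma_gt0 : forall k, 0 < gamma k).
Hypothesis (delta_gt0 : forall k, 0 < delta k).
Hypothesis (t_gt0 : forall k, 0 < t k) (t0_le : forall k, t 0%N <= t k).
Hypothesis (t_lambda : forall k, t k.+1 * lambda k.+1 = t k).
Hypothesis (t_theta : forall k, t k.+1 * theta k.+1 = t k).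
Hypothesis (t_tau : forall k,
  t k.+1 / tau k.+1 <= t k * ((1 + mu1 * tau k) / tau k)).
Hypothesis (t_sigma : forall k,
  t k.+1 / sigma k.+1 <= t k * ((1 + mu2 * sigma k) / sigma k)).
Hypothesis (eta_x_gt0 : 0 < eta_x) (eta_y_gt0 : 0 < eta_y).
Hypothesis (tau_bound : forall k i j,
  tau k * (Lxx * (lambda i * alpha i) + Lxy * (lambda i * beta i)
           + Lxx / alpha j + Lyx / gamma j) <= 1 - eta_x).
Hypothesis (sigma_bound : forall k i j,
  sigma k * (Lyx * (theta i * gamma i) + Lyy * (theta i * delta i)
             + Lxy / beta j + Lyy / delta j) <= 1 - eta_y).

Let a := merit Gx Gy Lxx Lxy Lyx Lyy tau sigma lambda theta alpha beta gamma
  delta xk yk.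
Let L x y := F1 x + P x y - F2 y.

Let x_cross k w :
  inner (Gx (xk k) (yk k) - Gx (xk k.-1) (yk k.-1)) w
  <= Lxx / (2 * alpha k) * `|xk k - xk k.-1| ^+ 2
     + Lxy / (2 * beta k) * `|yk k - yk k.-1| ^+ 2
     + (Lxx * alpha k + Lxy * beta k) / 2 * `|w| ^+ 2.
Proof. by apply: inner_young => //; exact: Gx_lip. Qed.

Let y_cross k w :
  inner (Gy (xk k) (yk k) - Gy (xk k.-1) (yk k.-1)) w
  <= Lyx / (2 * gamma k) * `|xk k - xk k.-1| ^+ 2
     + Lyy / (2 * delta k) * `|yk k - yk k.-1| ^+ 2
     + (Lyx * gamma k + Lyy * delta k) / 2 * `|w| ^+ 2.
Proof. by apply: inner_young => //; exact: Gy_lip. Qed.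

(** Ascent along [Gy] is descent along [- Gy], so the results on proximal steps apply to both
    variables. *)
Let y_stepN k w : D2 w ->
  let u := yk k
    - sigma k *: extrapolate (theta k) (fun j => - Gy (xk j) (yk j)) k in
  sigma k * F2 (yk k.+1) + 2^-1 * `|yk k.+1 - u| ^+ 2
    <= sigma k * F2 w + 2^-1 * `|w - u| ^+ 2.
Proof.
have -> : extrapolate (theta k) (fun j => - Gy (xk j) (yk j)) k
    = - extrapolate (theta k) (fun j => Gy (xk j) (yk j)) k.
  by rewrite /extrapolate !scalerN opprB opprK addrC.
by rewrite scalerN opprK; exact: y_step.
Qed.

(** Young's bound on the two inner products cancels the squared-step terms of [a k] exactly. What
    remains of the distance terms is controlled by the step size bounds, after dropping their
    nonnegative reciprocal terms. *)
Lemma merit_lower_bound k x y :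
  eta_x / (2 * tau k) * `|x - xk k| ^+ 2
  + eta_y / (2 * sigma k) * `|y - yk k| ^+ 2
  <= a k x y.
Proof.
have xc := ler_wpM2l (ltW (lambda_gt0 k)) (x_cross k (- (x - xk k))).
have yc := ler_wpM2l (ltW (theta_gt0 k)) (y_cross k (y - yk k)).
rewrite innerNr normrN in xc.
have tb : (lambda k * (Lxx * alpha k + Lxy * beta k) + eta_x / tau k)
      * `|x - xk k| ^+ 2
    <= (tau k)^-1 * `|x - xk k| ^+ 2.
  apply: ler_wpM2r; first exact: sqr_ge0.
  rewrite -(ler_pM2l (tau_gt0 k)) mulfV ?gt_eqF// mulrDr (mulrCA _ eta_x).
  rewrite mulfV ?gt_eqF// mulr1.
  have := tau_bound k k k.
  have : 0 <= tau k * (Lxx / alpha k + Lyx / gamma k).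
    by rewrite mulr_ge0 ?addr_ge0 ?divr_ge0// ltW.
  lra.
have sb : (theta k * (Lyx * gamma k + Lyy * delta k) + eta_y / sigma k)
      * `|y - yk k| ^+ 2
    <= (sigma k)^-1 * `|y - yk k| ^+ 2.
  apply: ler_wpM2r; first exact: sqr_ge0.
  rewrite -(ler_pM2l (sigma_gt0 k)) mulfV ?gt_eqF// mulrDr (mulrCA _ eta_y).
  rewrite mulfV ?gt_eqF// mulr1.
  have := sigma_bound k k k.
  have : 0 <= sigma k * (Lxy / beta k + Lyy / delta k).
    by rewrite mulr_ge0 ?addr_ge0 ?divr_ge0// ltW.
  lra.
rewrite /a /merit; move: xc yc tb sb; rewrite !invfM; lra.
Qed.

Lemma merit_ge0 k x y : 0 <= a k x y.
Proof.
apply: le_trans (merit_lower_bound k x y).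
by rewrite addr_ge0// mulr_ge0 ?sqr_ge0// divr_ge0 ?mulr_ge0// ltW.
Qed.

Lemma merit_descent k x y : D1 x -> D2 y ->
  t k * (L (xk k.+1) y - L x (yk k.+1))
  <= t k * a k x y - t k.+1 * a k.+1 x y
     - t k / 2 * (eta_x / tau k * `|xk k.+1 - xk k| ^+ 2
                  + eta_y / sigma k * `|yk k.+1 - yk k| ^+ 2).
Proof.
move=> Dx Dy.
have hx := forward_backward_step (Gx (xk k.+1) (yk k.+1)) F1_convex (tau_gt0 k)
  (xk_dom k.+1) Dx (@x_step k).
have hy := forward_backward_step (- Gy (xk k.+1) (yk k.+1)) F2_convex
  (sigma_gt0 k) (yk_dom k.+1) Dy (@y_stepN k).
have Px := P_gradx (xk k.+1) x (yk_dom k.+1).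
have Py := P_grady (yk k.+1) y (xk_dom k.+1).
have xc := ler_wpM2l (ltW (lambda_gt0 k)) (x_cross k (- (xk k.+1 - xk k))).
have yc := ler_wpM2l (ltW (theta_gt0 k)) (y_cross k (yk k.+1 - yk k)).
rewrite innerNr normrN in xc.
(* Before weighting: the squared previous steps of [a k] come from Young's bound on the cross terms
   at index [k]. *)
have gap : L (xk k.+1) y - L x (yk k.+1) <= a k x y
  - ((1 + mu1 * tau k) / (2 * tau k) * `|x - xk k.+1| ^+ 2
     + (1 + mu2 * sigma k) / (2 * sigma k) * `|y - yk k.+1| ^+ 2
     + inner (Gx (xk k.+1) (yk k.+1) - Gx (xk k) (yk k)) (x - xk k.+1)
     - inner (Gy (xk k.+1) (yk k.+1) - Gy (xk k) (yk k)) (y - yk k.+1))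
  - ((tau k)^-1 - lambda k * (Lxx * alpha k + Lxy * beta k)) / 2
     * `|xk k.+1 - xk k| ^+ 2
  - ((sigma k)^-1 - theta k * (Lyx * gamma k + Lyy * delta k)) / 2
     * `|yk k.+1 - yk k| ^+ 2.
  move: hx hy Px Py xc yc; rewrite /L /a /merit -(opprB x) -(opprB y).
  rewrite !innerE !invfM.
  lra.
(* The strong convexity gain pays for the growth of [t / tau]. *)
have xN : t k.+1 / tau k.+1 * `|x - xk k.+1| ^+ 2
    <= t k * ((1 + mu1 * tau k) / tau k) * `|x - xk k.+1| ^+ 2.
  by apply: ler_wpM2r (t_tau k); exact: sqr_ge0.
have yN : t k.+1 / sigma k.+1 * `|y - yk k.+1| ^+ 2
    <= t k * ((1 + mu2 * sigma k) / sigma k) * `|y - yk k.+1| ^+ 2.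
  by apply: ler_wpM2r (t_sigma k); exact: sqr_ge0.
(* The products with [alpha k], [beta k] come from the current Young bound, the reciprocals from
   [a k.+1]; hence the step size bound is used at indices [k] and [k.+1]. *)
have dx : (lambda k * (Lxx * alpha k + Lxy * beta k)
           + Lxx / alpha k.+1 + Lyx / gamma k.+1 + eta_x / tau k)
      * `|xk k.+1 - xk k| ^+ 2
    <= (tau k)^-1 * `|xk k.+1 - xk k| ^+ 2.
  apply: ler_wpM2r; first exact: sqr_ge0.
  rewrite -(ler_pM2l (tau_gt0 k)) mulfV ?gt_eqF// mulrDr (mulrCA _ eta_x).
  by rewrite mulfV ?gt_eqF// mulr1; have := tau_bound k k k.+1; lra.
have dy : (theta k * (Lyx * gamma k + Lyy * delta k)
           + Lxy / beta k.+1 + Lyy / delta k.+1 + eta_y / sigma k)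
      * `|yk k.+1 - yk k| ^+ 2
    <= (sigma k)^-1 * `|yk k.+1 - yk k| ^+ 2.
  apply: ler_wpM2r; first exact: sqr_ge0.
  rewrite -(ler_pM2l (sigma_gt0 k)) mulfV ?gt_eqF// mulrDr (mulrCA _ eta_y).
  by rewrite mulfV ?gt_eqF// mulr1; have := sigma_bound k k k.+1; lra.
(* Since [t k.+1 * lambda k.+1 = t k], and likewise for [theta], these terms carry the weight [t k]
   and cancel those in [gap]. *)
have aS : t k.+1 * a k.+1 x y =
    t k.+1 / tau k.+1 * `|x - xk k.+1| ^+ 2 / 2
    + t k.+1 / sigma k.+1 * `|y - yk k.+1| ^+ 2 / 2
    + t k * ((Lxx / alpha k.+1 + Lyx / gamma k.+1) / 2 * `|xk k.+1 - xk k| ^+ 2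
      + (Lxy / beta k.+1 + Lyy / delta k.+1) / 2 * `|yk k.+1 - yk k| ^+ 2
      + inner (Gx (xk k.+1) (yk k.+1) - Gx (xk k) (yk k)) (x - xk k.+1)
      - inner (Gy (xk k.+1) (yk k.+1) - Gy (xk k) (yk k)) (y - yk k.+1)).
  rewrite /a /merit /= !invfM.
  have <- : theta k.+1 = lambda k.+1.
    by apply: (mulfI (lt0r_neq0 (t_gt0 k.+1))); rewrite t_theta t_lambda.
  rewrite -(t_theta k); ring.
have := ler_wpM2l (ltW (t_gt0 k)) gap.
have := ler_wpM2l (ltW (t_gt0 k)) dx.
have := ler_wpM2l (ltW (t_gt0 k)) dy.
rewrite aS !invfM; move: xN yN; move: (a k x y) (L _ _) (L _ _) => A L1 L2.
lra.
Qed.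

Let gap0 x y := (2 * tau 0%N)^-1 * `|x - xk 0%N| ^+ 2
              + (2 * sigma 0%N)^-1 * `|y - yk 0%N| ^+ 2.

(** The gap splits into [F1 + P(., y)] and [F2 - P(x, .)], both convex, and Jensen is applied to
    each. *)
Lemma ergodic_gap_le K x y : D1 x -> D2 y -> (0 < K)%N ->
  [/\ D1 (weighted_avg t xk K), D2 (weighted_avg t yk K) &
      L (weighted_avg t xk K) y - L x (weighted_avg t yk K)
      <= K%:R^-1 * gap0 x y].
Proof.
move=> Dx Dy K0; set xh := weighted_avg t xk K; set yh := weighted_avg t yk K.
have [Dxh Fxh] := weighted_avg_jensen
  (strongly_convex_onD (strongly_convex_on_ge0 mu1_ge0 F1_convex) (P_convex Dy))
  t_gt0 (fun k => xk_dom k.+1) K0.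
have [Dyh Fyh] := weighted_avg_jensen
  (strongly_convex_onD (strongly_convex_on_ge0 mu2_ge0 F2_convex) (P_concave Dx))
  t_gt0 (fun k => yk_dom k.+1) K0.
split=> //; set T := \sum_(i < K) t i in Fxh Fyh.
(* This bound on the total weight is the source of the rate [1 / K]. *)
have T_ge : K%:R * t 0%N <= T.
  rewrite mulr_natl -[X in _ *+ X](card_ord K) -sumr_const.
  by apply: ler_sum => i _; exact: t0_le.
have KR0 : 0 < K%:R :> R by rewrite ltr0n.
have T0 : 0 < T by apply: lt_le_trans T_ge; rewrite mulr_gt0.
have g0 : 0 <= gap0 x y.
  by rewrite /gap0 addr_ge0// mulr_ge0 ?sqr_ge0// invr_ge0 mulr_ge0// ltW.
(* At index 0 the predecessor is again 0, so all increments vanish. *)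
have a0 : a 0%N x y = gap0 x y.
  by rewrite /a /merit /gap0 /= !subrr !normr0 !linear0l; ring.
have tel n : \sum_(k < n) t k * (L (xk k.+1) y - L x (yk k.+1))
    <= t 0%N * a 0%N x y - t n * a n x y.
  elim: n => [|n IH]; first by rewrite big_ord0 subrr.
  rewrite big_ord_recr/=; have := merit_descent n Dx Dy.
  have : 0 <= t n / 2 * (eta_x / tau n * `|xk n.+1 - xk n| ^+ 2
                     + eta_y / sigma n * `|yk n.+1 - yk n| ^+ 2).
    rewrite mulr_ge0 ?divr_ge0// ?(ltW (t_gt0 n))//.
    by rewrite addr_ge0// mulr_ge0 ?sqr_ge0// divr_ge0// ltW.
  move: IH; lra.
have : T * (L xh y - L x yh) <= t 0%N * gap0 x y.
  rewrite -a0;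
  apply: le_trans (_ : t 0%N * a 0%N x y - t K * a K x y <= _); last first.
    by rewrite gerBl mulr_ge0 ?merit_ge0// ltW.
  apply: le_trans (tel K).
  have -> : \sum_(k < K) t k * (L (xk k.+1) y - L x (yk k.+1))
    = \sum_(k < K) t k * (F1 (xk k.+1) + P (xk k.+1) y)
      + \sum_(k < K) t k * (F2 (yk k.+1) - P x (yk k.+1)) - T * (F2 y + F1 x).
    rewrite mulr_suml -big_split -sumrB /=; apply: eq_bigr => k _.
    by rewrite /L; ring.
  by move: Fxh Fyh; rewrite /L -/xh -/yh; lra.
move=> h; rewrite -(ler_pM2l T0) (le_trans h)// mulrA ler_wpM2r//.
by rewrite ler_pdivlMr// mulrC.
Qed.

Lemma merit_decreasing k x y : D1 x -> D2 y ->
  L x (yk k.+1) <= L (xk k.+1) y ->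
  t k.+1 * a k.+1 x y + t 0%N / 2 * (eta_x / tau k * `|xk k.+1 - xk k| ^+ 2
                                     + eta_y / sigma k * `|yk k.+1 - yk k| ^+ 2)
  <= t k * a k x y.
Proof.
move=> Dx Dy gap_ge0; have := merit_descent k Dx Dy.
have : 0 <= t k * (L (xk k.+1) y - L x (yk k.+1)).
  by rewrite mulr_ge0 ?subr_ge0// ltW.
set E := eta_x / _ * _ + _; have E0 : 0 <= E.
  by rewrite addr_ge0// mulr_ge0 ?sqr_ge0// divr_ge0// ltW.
by have := ler_wpM2r E0 (t0_le k); lra.
Qed.

(** * Consequences at a saddle point: boundedness and convergence of values *)

Section Saddle.
Context (xs : H1) (ys : H2).
Hypothesis (Dxs : D1 xs) (Dys : D2 ys).
Hypothesis (saddle_x : forall x, D1 x -> L xs ys <= L x ys).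
Hypothesis (saddle_y : forall y, D2 y -> L xs y <= L xs ys).

(** The chain [t_k a_k <= t_0 a_0 <= t_k a_0] allows division by [t_k]. *)
Lemma merit_le0 k : a k xs ys <= a 0%N xs ys.
Proof.
have tak : t k * a k xs ys <= t 0%N * a 0%N xs ys.
  elim: k => [//|k IH]; apply: le_trans IH.
  have := merit_decreasing Dxs Dys
    (le_trans (saddle_y (yk_dom k.+1)) (saddle_x (xk_dom k.+1))).
  have : 0 <= t 0%N / 2 * (eta_x / tau k * `|xk k.+1 - xk k| ^+ 2
                           + eta_y / sigma k * `|yk k.+1 - yk k| ^+ 2).
    rewrite mulr_ge0 ?divr_ge0// ?(ltW (t_gt0 0%N))//.
    by rewrite addr_ge0// mulr_ge0 ?sqr_ge0// divr_ge0// ltW.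
  by move=> E0 /(le_trans _); apply; rewrite lerDl.
rewrite -(ler_pM2l (t_gt0 0%N)); apply: le_trans tak.
by rewrite ler_wpM2r ?merit_ge0.
Qed.

Lemma iterates_bounded : exists M, forall k, `|xk k| <= M /\ `|yk k| <= M.
Proof.
have cx0 : [/\ 0 <= Lxx * (lambda 0%N * alpha 0%N),
    0 <= Lxy * (lambda 0%N * beta 0%N), 0 <= Lxx / alpha 0%N
    & 0 <= Lyx / gamma 0%N].
  by split; rewrite ?divr_ge0 ?mulr_ge0// ltW.
have cy0 : [/\ 0 <= Lyx * (theta 0%N * gamma 0%N),
    0 <= Lyy * (theta 0%N * delta 0%N), 0 <= Lxy / beta 0%N
    & 0 <= Lyy / delta 0%N].
  by split; rewrite ?divr_ge0 ?mulr_ge0// ltW.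
have mul0 (l m : R) : 0 < m -> l * m = 0 -> l = 0.
  by move=> m0 /eqP; rewrite mulf_eq0 (gt_eqF m0) orbF => /eqP.
have [Mx xM] : exists M, forall k, `|xk k| <= M.
  apply: (proximal_iterates_bounded (A := a 0%N xs ys) (gs := Gx xs ys) mu1_ge0
    F1_convex tau_gt0 xk_dom Dxs x_step eta_x_gt0 _ _
    (fun k => le_trans (tau_bound k 0%N 0%N) _)).
  - move=> k; apply: le_trans (merit_le0 k).
    apply: le_trans (merit_lower_bound k xs ys).
    by rewrite lerDl mulr_ge0 ?sqr_ge0// divr_ge0 ?mulr_ge0// ltW.
  - by case: cx0 => *; rewrite !addr_ge0.
  - by rewrite gerBl ltW.
  (* A vanishing sum of nonnegative terms makes each term vanish; positive parameters then force
     [Lxx = Lxy = 0]. *)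
  case: cx0 => p1 p2 p3 p4 c0.
  have Lxx0 : Lxx = 0.
    by apply: (@mul0 _ (lambda 0%N * alpha 0%N)); [rewrite mulr_gt0|lra].
  have Lxy0 : Lxy = 0.
    by apply: (@mul0 _ (lambda 0%N * beta 0%N)); [rewrite mulr_gt0|lra].
  have Gx_const x y : D1 x -> D2 y -> Gx x y = Gx xs ys.
    move=> Dx Dy; apply/eqP; rewrite -subr_eq0 -normr_le0.
    by have := Gx_lip Dx Dy Dxs Dys; rewrite Lxx0 Lxy0 !mul0r addr0.
  split=> [k|x Dx]; first exact: Gx_const.
  (* The gradient inequality is based at [x]: with a constant gradient it bounds [P x ys] from
     above, and the saddle inequality gives optimality of [xs]. *)
  have := P_gradx x xs Dys; rewrite Gx_const// -(opprB x) innerNr.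
  by have := saddle_x Dx; rewrite /L; lra.
have [My yM] : exists M, forall k, `|yk k| <= M.
  apply: (proximal_iterates_bounded (A := a 0%N xs ys) (gs := - Gy xs ys) mu2_ge0
    F2_convex sigma_gt0 yk_dom Dys y_stepN eta_y_gt0 _ _
    (fun k => le_trans (sigma_bound k 0%N 0%N) _)).
  - move=> k; apply: le_trans (merit_le0 k).
    apply: le_trans (merit_lower_bound k xs ys).
    by rewrite lerDr mulr_ge0 ?sqr_ge0// divr_ge0 ?mulr_ge0// ltW.
  - by case: cy0 => *; rewrite !addr_ge0.
  - by rewrite gerBl ltW.
  case: cy0 => p1 p2 p3 p4 c0.
  have Lyx0 : Lyx = 0.
    by apply: (@mul0 _ (theta 0%N * gamma 0%N)); [rewrite mulr_gt0|lra].
  have Lyy0 : Lyy = 0.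
    by apply: (@mul0 _ (theta 0%N * delta 0%N)); [rewrite mulr_gt0|lra].
  have Gy_const x y : D1 x -> D2 y -> Gy x y = Gy xs ys.
    move=> Dx Dy; apply/eqP; rewrite -subr_eq0 -normr_le0.
    by have := Gy_lip Dx Dy Dxs Dys; rewrite Lyx0 Lyy0 !mul0r addr0.
  split=> [k|y Dy]; first by rewrite Gy_const.
  have := P_grady y ys Dxs; rewrite Gy_const// -(opprB y) innerNr innerNl.
  by have := saddle_y Dy; rewrite /L; lra.
exists (Num.max Mx My) => k; split.
  by rewrite le_max xM.
by rewrite le_max yM orbT.
Qed.

Lemma ergodic_value_le : exists C, forall K, (0 < K)%N ->
  `|L (weighted_avg t xk K) (weighted_avg t yk K) - L xs ys| <= K%:R^-1 * C.
Proof.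
have [M zM] := iterates_bounded.
have M0 : 0 <= M by case: (zM 0%N) => x0M _; exact: le_trans x0M.
(* [B] bounds the distances from the initial iterates to both [(xs, yh)] and [(xh, ys)]. *)
pose B := 2 * M + `|xs| + `|ys|.
exists ((2 * tau 0%N)^-1 * B ^+ 2 + (2 * sigma 0%N)^-1 * B ^+ 2) => K K0.
have [Dxh Dyh _] := ergodic_gap_le Dxs Dys K0.
have [xhM _] := weighted_avg_jensen (@strongly_convex_on_ball R H1 M)
  t_gt0 (fun k => (zM k.+1).1) K0.
have [yhM _] := weighted_avg_jensen (@strongly_convex_on_ball R H2 M)
  t_gt0 (fun k => (zM k.+1).2) K0.
move: Dxh Dyh xhM yhM; set xh := weighted_avg t xk K.
set yh := weighted_avg t yk K; move=> Dxh Dyh /= xhM yhM.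
have [x0M y0M] := zM 0%N.
have gap0_le x y : `|x| <= M + `|xs| -> `|y| <= M + `|ys| ->
    gap0 x y <= (2 * tau 0%N)^-1 * B ^+ 2 + (2 * sigma 0%N)^-1 * B ^+ 2.
  move=> xM yM.
  have B0 : 0 <= B by rewrite !addr_ge0// mulr_ge0.
  apply: lerD; apply: ler_wpM2l;
    rewrite ?invr_ge0 ?mulr_ge0 ?(ltW (tau_gt0 _)) ?(ltW (sigma_gt0 _))//.
    rewrite ler_pXn2r ?nnegrE// (le_trans (ler_normB _ _))// /B.
    by have := normr_ge0 ys; lra.
  rewrite ler_pXn2r ?nnegrE// (le_trans (ler_normB _ _))// /B.
  by have := normr_ge0 xs; lra.
have KV0 : 0 <= K%:R^-1 :> R by rewrite invr_ge0.
(* With [saddle_y], [up] bounds the value at the averages from above; with [saddle_x], [lo] bounds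
   it from below. *)
have [_ _ up] := ergodic_gap_le Dxs Dyh K0.
have [_ _ lo] := ergodic_gap_le Dxh Dys K0.
have up0 : gap0 xs yh <= (2 * tau 0%N)^-1 * B ^+ 2 + (2 * sigma 0%N)^-1 * B ^+ 2.
  by apply: gap0_le; rewrite ?lerDr// (le_trans yhM)// lerDl.
have lo0 : gap0 xh ys <= (2 * tau 0%N)^-1 * B ^+ 2 + (2 * sigma 0%N)^-1 * B ^+ 2.
  by apply: gap0_le; rewrite ?lerDr// (le_trans xhM)// lerDl.
have := ler_wpM2l KV0 up0; have := ler_wpM2l KV0 lo0.
have := saddle_x Dxh; have := saddle_y Dyh; move: up lo.
rewrite -/xh -/yh => ? ? ? ? ? ?; rewrite ler_norml; apply/andP; split; lra.
Qed.

End Saddle.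

End PrimalDual.

(** * From extended-real hypotheses to real inequalities *)

Lemma prox_fine (R : realType) (V : normedModType R) (f : V -> \bar R)
    (tau : R) (u p : V) :
  eproper f -> 0 < tau -> prox (fun z => (tau%:E * f z)%E) u p ->
  dom f p /\ forall w, dom f w ->
    tau * fine (f p) + 2^-1 * `|p - u| ^+ 2
      <= tau * fine (f w) + 2^-1 * `|w - u| ^+ 2.
Proof.
move=> [fNy [w0 Dw0]] tau0 pmin.
have fE w : dom f w -> f w = (fine (f w))%:E.
  by move=> Dw; rewrite fineK// fin_numE fNy lt_eqF.
(* An infinite objective at [p] could not be below the finite one at [w0]; [tau > 0] keeps the
   product infinite. *)
have Dp : dom f p.
  rewrite /dom/= ltey; apply/eqP => fp; have := pmin w0.
  by rewrite (fE w0 Dw0) fp gt0_muley// -EFinM.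
by split=> // w Dw; have := pmin w; rewrite (fE w Dw) (fE p Dp).
Qed.

(** Suprema and infima decouple the indices, which is why [k], [i] and [j] are independent. *)
Lemma step_size_le (R : realType) (L1 L2 L3 L4 eta : R)
    (tau u1 u2 v1 v2 : nat -> R) :
  0 <= L1 -> 0 <= L2 -> 0 <= L3 -> 0 <= L4 -> (forall k, 0 < tau k) ->
  (forall k, 0 < u1 k) -> (forall k, 0 < u2 k) ->
  (forall k, 0 < v1 k) -> (forall k, 0 < v2 k) ->
  (eta%:E = 1 - seq_sup tau * (L1%:E * seq_sup u1 + L2%:E * seq_sup u2
                               + L3%:E / seq_inf v1 + L4%:E / seq_inf v2))%E ->
  forall k i j, tau k * (L1 * u1 i + L2 * u2 i + L3 / v1 j + L4 / v2 j) <= 1 - eta.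
Proof.
move=> L10 L20 L30 L40 tau0 u10 u20 v10 v20 etaE k i j.
have sup_ge (u : nat -> R) n : ((u n)%:E <= seq_sup u)%E.
  by apply: ereal_sup_ubound; exists n.
have inf_ge0 (v : nat -> R) : (forall n, 0 < v n) -> (0 <= seq_inf v)%E.
  by move=> v0; apply: le_ereal_inf_tmp => _ [n _ <-]; rewrite lee_fin ltW.
have div_le (l : R) (v : nat -> R) n : 0 <= l -> (forall n, 0 < v n) ->
    ((l / v n)%:E <= l%:E / seq_inf v)%E.
  move=> l0 v0; rewrite EFinM lee_wpmul2l ?lee_fin//.
  have -> : ((v n)^-1)%:E = ((v n)%:E)^-1%E by rewrite inver gt_eqF.
  (* The infimum may be 0: order reversal of the inverse only asks for nonnegativity. *)
  rewrite lee_pV2 ?inE/= ?lee_fin ?inf_ge0// ?(ltW (v0 n))//.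
  by apply: ereal_inf_lbound; exists n.
suff : ((tau k * (L1 * u1 i + L2 * u2 i + L3 / v1 j + L4 / v2 j))%:E
    <= seq_sup tau * (L1%:E * seq_sup u1 + L2%:E * seq_sup u2
                      + L3%:E / seq_inf v1 + L4%:E / seq_inf v2))%E.
  (* As [eta] is real, the product [X] cannot be infinite. *)
  move: etaE; set X := (seq_sup tau * _)%E; case: X => [r [->]||]/=; [|by []|by []].
  by rewrite lee_fin; lra.
rewrite EFinM; apply: lee_pmul => //.
- by rewrite lee_fin ltW.
- by rewrite lee_fin !addr_ge0// ?mulr_ge0// ?invr_ge0 ltW.
rewrite !EFinD !leeD ?div_le//.
  by rewrite EFinM lee_wpmul2l ?lee_fin.
by rewrite EFinM lee_wpmul2l ?lee_fin.
Qed.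

Lemma weight_step_le (R : realType) (s s' th tau tau' mu : R) :
  s' * th = s -> 0 <= s' -> 0 < th -> 0 < tau -> 0 < tau' -> 0 <= mu ->
  tau / (th * (1 + mu * tau)) <= tau' ->
  s' / tau' <= s * ((1 + mu * tau) / tau).
Proof.
move=> <- s'0 th0 tau0 tau'0 mu0 h; rewrite ler_pdivrMr//.
have mt : 0 < 1 + mu * tau by rewrite ltr_wpDr// mulr_ge0// ltW.
(* Multiplied by this factor, the left side of the recursion becomes exactly [s']. *)
have c0 : 0 <= s' * th * ((1 + mu * tau) / tau).
  exact: mulr_ge0 (mulr_ge0 s'0 (ltW th0)) (divr_ge0 (ltW mt) (ltW tau0)).
apply: le_trans (ler_wpM2l c0 h); rewrite le_eqVlt; apply/orP; left; apply/eqP.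
by field; rewrite !gt_eqF.
Qed.

Lemma is_gradientN (R : realType) (V : hilbertType R) (F : V -> R) (u g : V) :
  is_gradient F u g -> is_gradient (fun v => - F v) u (- g).
Proof.
move=> dF; have := is_diffN dF; rewrite /is_gradient.
by congr (is_diff _ _ _); apply/funext => h; rewrite innerNl.
Qed.

Theorem theorem3p11 (R : realType) (H1 H2 : hilbertType R)
  (* data of the problem *)
  (f1 : H1 -> \bar R) (f2 : H2 -> \bar R) (Phi : H1 -> H2 -> \bar R)
  (mu1 mu2 : R) (Gx : H1 -> H2 -> H1) (Gy : H1 -> H2 -> H2)
  (Lxx Lxy Lyx Lyy : R)
  (* iterates and parameters *)
  (xk : nat -> H1) (yk : nat -> H2)
  (tau sigma lambda theta : nat -> R)
  (alpha beta gamma delta t : nat -> R)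
  (xs : H1) (ys : H2) (eta_x eta_y : R)
  (* standing assumptions *)
  (mu1_ge0 : 0 <= mu1) (mu2_ge0 : 0 <= mu2)
  (f1_proper : eproper f1) (f2_proper : eproper f2)
  (f1_lsc : lower_semicontinuous f1) (f2_lsc : lower_semicontinuous f2)
  (f1_convex : convex_modulus mu1 f1) (f2_convex : convex_modulus mu2 f2)
  (dom1 : [/\ dom f1 !=set0, closed (dom f1) & convex_set (dom f1)])
  (dom2 : [/\ dom f2 !=set0, closed (dom f2) & convex_set (dom f2)])
  (Phi_x : forall y, dom f2 y ->
    [/\ forall x, Phi x y \is a fin_num,
        convex_function setT (fun x => fine (Phi x y))
      & forall x, is_gradient (fun x' => fine (Phi x' y)) x (Gx x y)])
  (Phi_y : forall x, dom f1 x ->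
    [/\ forall y, Phi x y \is a fin_num,
        convex_function setT (fun y => - fine (Phi x y))
      & forall y, is_gradient (fun y' => fine (Phi x y')) y (Gy x y)])
  (Lxx_ge0 : 0 <= Lxx) (Lxy_ge0 : 0 <= Lxy)
  (Lyx_ge0 : 0 <= Lyx) (Lyy_ge0 : 0 <= Lyy)
  (Gx_lipschitz : forall x y x' y',
    dom f1 x -> dom f2 y -> dom f1 x' -> dom f2 y' ->
    `|Gx x y - Gx x' y'| <= Lxx * `|x - x'| + Lxy * `|y - y'|)
  (Gy_lipschitz : forall x y x' y',
    dom f1 x -> dom f2 y -> dom f1 x' -> dom f2 y' ->
    `|Gy x y - Gy x' y'| <= Lyx * `|x - x'| + Lyy * `|y - y'|)
  (* algorithm *)
  (x0_dom : dom f1 (xk 0%N)) (y0_dom : dom f2 (yk 0%N))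
  (tau_gt0 : forall k, 0 < tau k) (sigma_gt0 : forall k, 0 < sigma k)
  (lambda_gt0 : forall k, 0 < lambda k) (theta_gt0 : forall k, 0 < theta k)
  (x_step : forall k, prox (fun z => ((tau k)%:E * f1 z)%E)
     (xk k - tau k *: extrapolate (lambda k) (fun j => Gx (xk j) (yk j)) k)
     (xk k.+1))
  (y_step : forall k, prox (fun z => ((sigma k)%:E * f2 z)%E)
     (yk k + sigma k *: extrapolate (theta k) (fun j => Gy (xk j) (yk j)) k)
     (yk k.+1))
  (* auxiliary parameters *)
  (alpha_gt0 : forall k, 0 < alpha k) (beta_gt0 : forall k, 0 < beta k)
  (gamma_gt0 : forall k, 0 < gamma k) (delta_gt0 : forall k, 0 < delta k)
  (t_ge0 : forall k, 0 <= t k) (t0_gt0 : 0 < t 0%N)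
  (* hypotheses of the theorem *)
  (saddle : is_saddle (saddle_fun f1 Phi f2) xs ys)
  (lambda_theta : forall k, lambda k = theta k) (theta_le1 : forall k, theta k <= 1)
  (lambda0 : lambda 0%N = 1) (theta0 : theta 0%N = 1)
  (tE : forall k, t k = t 0%N / \prod_(1 <= i < k.+1) theta i)
  (tau_rec : forall k,
    tau k.+1 >= tau k / (theta k.+1 * (1 + mu1 * tau k)))
  (sigma_rec : forall k,
    sigma k.+1 >= sigma k / (theta k.+1 * (1 + mu2 * sigma k)))
  (eta_xE : eta_x%:E = (1 - seq_sup tau *
     (Lxx%:E * seq_sup (fun k => (lambda k * alpha k)%R)
      + Lxy%:E * seq_sup (fun k => (lambda k * beta k)%R)
      + Lxx%:E / seq_inf alpha + Lyx%:E / seq_inf gamma))%E)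
  (eta_x_gt0 : 0 < eta_x)
  (eta_yE : eta_y%:E = (1 - seq_sup sigma *
     (Lyx%:E * seq_sup (fun k => (theta k * gamma k)%R)
      + Lyy%:E * seq_sup (fun k => (theta k * delta k)%R)
      + Lxy%:E / seq_inf beta + Lyy%:E / seq_inf delta))%E)
  (eta_y_gt0 : 0 < eta_y) :
  let f := saddle_fun f1 Phi f2 in
  let xhat := weighted_avg t xk in
  let yhat := weighted_avg t yk in
  let a := merit Gx Gy Lxx Lxy Lyx Lyy
             tau sigma lambda theta alpha beta gamma delta xk yk in
  [/\ (* i *)
      forall K : nat, (0 < K)%N ->
        (0 <= f (xhat K) ys - f xs (yhat K))%E /\
        (f (xhat K) ys - f xs (yhat K) <=
           (K%:R^-1 * ((2 * tau 0%N)^-1 * `|xs - xk 0%N| ^+ 2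
                       + (2 * sigma 0%N)^-1 * `|ys - yk 0%N| ^+ 2))%:E)%E,
      (* ii *)
      forall k, t k * a k xs ys >= t k.+1 * a k.+1 xs ys
        + t 0%N / 2 * (eta_x / tau k * `|xk k.+1 - xk k| ^+ 2
                     + eta_y / sigma k * `|yk k.+1 - yk k| ^+ 2),
      (* iii *)
      [/\ exists2 l : R, 0 <= l & (fun k => t k * a k xs ys) @ \oo --> l,
          bounded_fun xk & bounded_fun yk]
    & (* iv *)
      (fun k => (f (xhat k) (yhat k) - f xs ys)%E) @ \oo --> (0%:E : \bar R)].
Proof.
move=> f xhat yhat a.
have [f1Ny _] := f1_proper; have [f2Ny _] := f2_proper.
pose F1 := fine \o f1; pose F2 := fine \o f2.
pose P x y := fine (Phi x y).
have f1E x : dom f1 x -> f1 x = (F1 x)%:E.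
  by move=> Dx; rewrite fineK// fin_numE f1Ny lt_eqF.
have f2E y : dom f2 y -> f2 y = (F2 y)%:E.
  by move=> Dy; rewrite fineK// fin_numE f2Ny lt_eqF.
have PhiE x y : dom f2 y -> Phi x y = (P x y)%:E.
  by move=> /Phi_x[Phi_fin _ _]; rewrite fineK.
have PhiE' x y : dom f1 x -> Phi x y = (P x y)%:E.
  by move=> /Phi_y[Phi_fin _ _]; rewrite fineK.
have fE x y : dom f1 x -> dom f2 y -> f x y = (F1 x + P x y - F2 y)%:E.
  by move=> Dx Dy; rewrite /f /saddle_fun f1E// f2E// PhiE.
have xk_dom k : dom f1 (xk k).
  by case: k => // k; have [] := prox_fine f1_proper (tau_gt0 k) (x_step k).
have yk_dom k : dom f2 (yk k).
  by case: k => // k; have [] := prox_fine f2_proper (sigma_gt0 k) (y_step k).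
(* Otherwise [f xs (yk 0)] is +oo, and the saddle inequalities pass this on to [f (xk 0) ys], which
   is real or -oo. *)
have Dxs : dom f1 xs.
  rewrite /dom/= ltey; apply/eqP => f1y.
  have [] := saddle (xk 0%N) (yk 0%N); rewrite -/f {1}/f/saddle_fun f1y.
  rewrite (PhiE _ _ y0_dom) (f2E _ y0_dom) /= => h.
  have {h} := le_trans h (saddle (xk 0%N) ys).2.
  rewrite /f /saddle_fun (f1E _ x0_dom) (PhiE' _ _ x0_dom).
  by case: (f2 ys) (f2Ny ys).
(* Otherwise [f xs ys] is -oo, yet it dominates the real value [f xs (yk 0)]. *)
have Dys : dom f2 ys.
  rewrite /dom/= ltey; apply/eqP => f2y.
  have [] := saddle xs (yk 0%N); rewrite -/f fE// /f /saddle_fun f2y.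
  by rewrite f1E// PhiE'.
have tS k : t k.+1 * theta k.+1 = t k.
  rewrite (tE k.+1) (tE k) (big_nat_recr k.+1)//= invfM mulrA divfK//.
  by rewrite gt_eqF.
have t_gt0 k : 0 < t k.
  by rewrite tE divr_gt0// prodr_gt0.
have t0_le k : t 0%N <= t k.
  elim: k => // k; move/le_trans; apply.
  by rewrite -(tS k) ger_pMr.
have saddle_x x : dom f1 x -> F1 xs + P xs ys - F2 ys <= F1 x + P x ys - F2 ys.
  by move=> Dx; have [_] := saddle x ys; rewrite -/f !fE// lee_fin.
have saddle_y y : dom f2 y -> F1 xs + P xs y - F2 y <= F1 xs + P xs ys - F2 ys.
  by move=> Dy; have [+ _] := saddle xs y; rewrite -/f !fE// lee_fin.
have F1c := convex_modulus_strongly_convex_on f1Ny f1_convex.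
have F2c := convex_modulus_strongly_convex_on f2Ny f2_convex.
have Pc y : dom f2 y -> strongly_convex_on setT 0 (P^~ y).
  by move=> /Phi_x[_ c _]; exact: convex_function_strongly_convex_on.
have Pcc x : dom f1 x -> strongly_convex_on setT 0 (fun y => - P x y).
  by move=> /Phi_y[_ c _]; exact: convex_function_strongly_convex_on.
have Pgx x x' y : dom f2 y -> P x y + inner (Gx x y) (x' - x) <= P x' y.
  move=> Dy; have [_ _ g] := Phi_x _ Dy.
  exact: (convex_gradient_le x' (Pc _ Dy) (g x)).
have Pgy x y y' : dom f1 x -> P x y' <= P x y + inner (Gy x y) (y' - y).
  move=> Dx; have [_ _ g] := Phi_y _ Dx.
  have := convex_gradient_le y' (Pcc _ Dx) (is_gradientN (g y)).
  by rewrite innerNl; lra.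
have xst k := (prox_fine f1_proper (tau_gt0 k) (x_step k)).2.
have yst k := (prox_fine f2_proper (sigma_gt0 k) (y_step k)).2.
have t_lambda k : t k.+1 * lambda k.+1 = t k by rewrite lambda_theta.
have t_tau k : t k.+1 / tau k.+1 <= t k * ((1 + mu1 * tau k) / tau k).
  exact: weight_step_le (tS k) _ _ _ _ _ (tau_rec k).
have t_sigma k : t k.+1 / sigma k.+1 <= t k * ((1 + mu2 * sigma k) / sigma k).
  exact: weight_step_le (tS k) _ _ _ _ _ (sigma_rec k).
have tau_b := step_size_le Lxx_ge0 Lxy_ge0 Lxx_ge0 Lyx_ge0 tau_gt0
  (fun k => mulr_gt0 (lambda_gt0 k) (alpha_gt0 k))
  (fun k => mulr_gt0 (lambda_gt0 k) (beta_gt0 k)) alpha_gt0 gamma_gt0 eta_xE.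
have sigma_b := step_size_le Lyx_ge0 Lyy_ge0 Lxy_ge0 Lyy_ge0 sigma_gt0
  (fun k => mulr_gt0 (theta_gt0 k) (gamma_gt0 k))
  (fun k => mulr_gt0 (theta_gt0 k) (delta_gt0 k)) beta_gt0 delta_gt0 eta_yE.
have a_ge0 k x y : 0 <= a k x y.
  exact: (merit_ge0 Lxx_ge0 Lxy_ge0 Lyx_ge0 Lyy_ge0 Gx_lipschitz Gy_lipschitz
    xk_dom yk_dom tau_gt0 sigma_gt0 lambda_gt0 theta_gt0
    alpha_gt0 beta_gt0 gamma_gt0 delta_gt0 eta_x_gt0 eta_y_gt0 tau_b sigma_b).
have gap_le K : (0 < K)%N -> [/\ dom f1 (xhat K), dom f2 (yhat K) &
      F1 (xhat K) + P (xhat K) ys - F2 ys - (F1 xs + P xs (yhat K) - F2 (yhat K))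
      <= K%:R^-1 * ((2 * tau 0%N)^-1 * `|xs - xk 0%N| ^+ 2
                    + (2 * sigma 0%N)^-1 * `|ys - yk 0%N| ^+ 2)].
  exact: (ergodic_gap_le mu1_ge0 mu2_ge0 F1c F2c Pc Pcc Pgx Pgy
    Lxx_ge0 Lxy_ge0 Lyx_ge0 Lyy_ge0 Gx_lipschitz Gy_lipschitz
    xk_dom yk_dom tau_gt0 sigma_gt0 lambda_gt0 theta_gt0 xst yst
    alpha_gt0 beta_gt0 gamma_gt0 delta_gt0 t_gt0 t0_le t_lambda tS
    t_tau t_sigma eta_x_gt0 eta_y_gt0 tau_b sigma_b).
have descent k : t k.+1 * a k.+1 xs ys
    + t 0%N / 2 * (eta_x / tau k * `|xk k.+1 - xk k| ^+ 2
                   + eta_y / sigma k * `|yk k.+1 - yk k| ^+ 2)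
    <= t k * a k xs ys.
  exact: (merit_decreasing F1c F2c Pgx Pgy
    Lxx_ge0 Lxy_ge0 Lyx_ge0 Lyy_ge0 Gx_lipschitz Gy_lipschitz
    xk_dom yk_dom tau_gt0 sigma_gt0 lambda_gt0 theta_gt0 xst yst
    alpha_gt0 beta_gt0 gamma_gt0 delta_gt0 t_gt0 t0_le t_lambda tS
    t_tau t_sigma eta_x_gt0 eta_y_gt0 tau_b sigma_b Dxs Dys
    (le_trans (saddle_y _ (yk_dom _)) (saddle_x _ (xk_dom _)))).
have [M zM] := iterates_bounded mu1_ge0 mu2_ge0 F1c F2c Pgx Pgy
    Lxx_ge0 Lxy_ge0 Lyx_ge0 Lyy_ge0 Gx_lipschitz Gy_lipschitz
    xk_dom yk_dom tau_gt0 sigma_gt0 lambda_gt0 theta_gt0 xst yst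
    alpha_gt0 beta_gt0 gamma_gt0 delta_gt0 t_gt0 t0_le t_lambda tS
    t_tau t_sigma eta_x_gt0 eta_y_gt0 tau_b sigma_b Dxs Dys saddle_x saddle_y.
have [C valueC] : exists C, forall K, (0 < K)%N ->
    `|F1 (xhat K) + P (xhat K) (yhat K) - F2 (yhat K) - (F1 xs + P xs ys - F2 ys)|
    <= K%:R^-1 * C.
  exact: (ergodic_value_le mu1_ge0 mu2_ge0 F1c F2c Pc Pcc Pgx Pgy
    Lxx_ge0 Lxy_ge0 Lyx_ge0 Lyy_ge0 Gx_lipschitz Gy_lipschitz
    xk_dom yk_dom tau_gt0 sigma_gt0 lambda_gt0 theta_gt0 xst yst
    alpha_gt0 beta_gt0 gamma_gt0 delta_gt0 t_gt0 t0_le t_lambda tS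
    t_tau t_sigma eta_x_gt0 eta_y_gt0 tau_b sigma_b Dxs Dys saddle_x saddle_y).
split.
- move=> K /gap_le[Dxh Dyh gapK]; rewrite !fE// -EFinB !lee_fin; split=> //.
  by rewrite subr_ge0 (le_trans (saddle_y _ Dyh))// saddle_x.
- exact: descent.
- have ta_ge0 k : 0 <= t k * a k xs ys by rewrite mulr_ge0// ltW.
  have cv : cvgn (fun k => t k * a k xs ys).
    apply: nonincreasing_is_cvgn; last by exists 0 => _ [k _ <-].
    apply/nonincreasing_seqP => k; apply: le_trans (descent k).
    rewrite lerDl mulr_ge0 ?divr_ge0// ?(ltW (t_gt0 0%N))//.
    by rewrite addr_ge0// mulr_ge0 ?sqr_ge0// divr_ge0// ltW.
  split.
  + exists (limn (fun k => t k * a k xs ys)); last exact: cv.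
    by apply: limr_ge => //; exact: nearW.
  + exists M; split; first exact: num_real.
    by move=> N /ltW MN k _ /=; rewrite (le_trans (zM k).1).
  + exists M; split; first exact: num_real.
    by move=> N /ltW MN k _ /=; rewrite (le_trans (zM k).2).
(* The average at index 0 is empty and may leave the domain, so the sequence is shifted before it is
   read in the reals; the bound [C / (k+1)] is then [C * harmonic k]. *)
rewrite -cvg_shiftS /=.
have -> : (fun k => f (xhat k.+1) (yhat k.+1) - f xs ys)%E = EFin \o (fun k =>
    F1 (xhat k.+1) + P (xhat k.+1) (yhat k.+1) - F2 (yhat k.+1)
    - (F1 xs + P xs ys - F2 ys)).
  by apply/funext => k /=; have [//|Dxh Dyh _] := gap_le k.+1; rewrite !fE.
apply: cvg_EFin; first exact: nearW.
apply/norm_cvg0P.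
apply: (@squeeze_cvgr _ _ _ _ (fun=> 0) (fun k => C * harmonic k)).
- by apply: nearW => k /=; rewrite normr_ge0 mulrC valueC.
- exact: cvg_cst.
by rewrite -[X in _ --> X](mulr0 C); apply: cvgMr; exact: cvg_harmonic.
Qed.
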